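(* Consider the set of all complex roots of the denominators $q(x)$ of the vertices $p(x)/q(x)$ of the backward tree. This set is dense on the unit circle, i.e. every point of $\{z\in\mathbb{C}:|z|=1\}$ lies in its closure.
   Context: The backward tree (backward Farey tree) is the infinite rooted binary tree whose nodes (vertices) carry rational functions $p(x)/q(x)$, whose root is $\frac{1}{x+1}$, and where the node carrying $p/q$ has two children $$\Phi_0\left(\frac{p(x)}{q(x)}\right)=\frac{(x-1)p(x)+q(x)}{(x+1)q(x)-p(x)},\qquad \Phi_1\left(\frac{p(x)}{q(x)}\right)=\frac{p(x)}{x\,q(x)+p(x)},$$ with fractions simplified (common polynomial factors cancelled). *)

(* Defs.v *)
From HB Require Import structures.
From mathcomp Require Import all_boot all_order all_algebra complex.
From mathcomp Require Import boolp classical_sets reals topology normedtype.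
Set Implicit Arguments.
Unset Strict Implicit.
Unset Printing Implicit Defensive.
Import Order.TTheory GRing.Theory Num.Theory numFieldNormedType.Exports.
Local Open Scope ring_scope.
Local Open Scope complex_scope.
Local Open Scope classical_set_scope.

(* A pair (p, q) stands for the rational function p / q. *)
Definition simplify (f : {poly rat} * {poly rat}) : {poly rat} * {poly rat} :=
  let d := gcdp f.1 f.2 in (f.1 %/ d, f.2 %/ d).

Definition Phi0 (f : {poly rat} * {poly rat}) : {poly rat} * {poly rat} :=
  simplify (('X - 1) * f.1 + f.2, ('X + 1) * f.2 - f.1).

Definition Phi1 (f : {poly rat} * {poly rat}) : {poly rat} * {poly rat} :=
  simplify (f.1, 'X * f.2 + f.1).

(* Vertices of the infinite rooted binary tree are finite binary words: [::]
   is the root, and the two children of w are false :: w and true :: w.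
   The fraction carried by a vertex is in lowest terms, with numerator and
   denominator determined up to a common nonzero rational constant. *)
Fixpoint backward_tree (w : seq bool) : {poly rat} * {poly rat} :=
  match w with
  | [::] => (1, 'X + 1)
  | b :: w' => (if b then Phi1 else Phi0) (backward_tree w')
  end.

Definition denominator (w : seq bool) : {poly rat} := (backward_tree w).2.

(* The ascription to numFieldType makes the topology of the modulus on R[i]
   available to inference. *)
Definition denominator_roots (R : realType) : set (R[i] : numFieldType) :=
  [set z | exists w : seq bool, root (map_poly ratr (denominator w)) z].

Definition unit_circle (R : realType) : set (R[i] : numFieldType) :=
  [set z | `|z| = 1].

Arguments denominator_roots R _ : clear implicits.
Arguments unit_circle R _ : clear implicits.

(* Main.v *)
(** Iterating [Phi1] from the root gives the fractions
    [1 / (1 + x + ... + x^(n+1))], whose denominators vanish at every root of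
    unity other than 1.  It is therefore enough to approximate a point [z] of
    the circle by solutions of [y^(2^k) = -1].  This goes by taking square roots:
    if [y^2] is close to [z^2], then the parallelogram law makes one of
    [|z - y|^2], [|z + y|^2] at least 2, so the other is at most half of
    [|z^2 - y^2|^2]. *)
Require Import Defs.
From mathcomp Require Import all_boot all_order all_algebra complex.
From mathcomp Require Import boolp classical_sets reals topology normedtype.
From mathcomp Require Import ring.
Import Order.TTheory GRing.Theory Num.Theory.
Import numFieldNormedType.Exports.
Local Open Scope ring_scope.
Local Open Scope classical_set_scope.

(** A nonzero constant is coprime to [q], so the gcd is a unit, but which unit [gcdp] returns is
    left open; hence the unspecified [d]. *)
Lemma simplify_constl (c : rat) (q : {poly rat}) : c != 0 ->
  exists2 d : rat, d != 0 & simplify (c%:P, q) = (d%:P, (d / c) *: q).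
Proof.
move=> c0; rewrite /simplify /=.
have : size (gcdp c%:P q) == 1%N.
  have: coprimep c%:P q by rewrite -[c%:P]mulr1 mul_polyC coprimepZl ?coprime1p.
  by rewrite coprimep_def.
case/size_poly1P => a a0 ->.
exists (c / a); first by rewrite mulf_neq0 ?invr_eq0.
rewrite -[a%:P]mulr1 mul_polyC !(divpZr _ _ a0) !divp1 mulrAC divff // mul1r.
by rewrite -mul_polyC -polyCM mulrC.
Qed.

Lemma backward_tree_true (n : nat) : exists2 c : rat, c != 0 &
  backward_tree (nseq n true) = (c%:P, c *: \sum_(i < n.+2) 'X^i).
Proof.
elim: n => [|n [c c0 IHn]].
  by exists 1; rewrite ?oner_neq0 //= scale1r big_ord_recr big_ord1 /= addrC.
have [d d0 Ed] := simplify_constl c ('X * (c *: \sum_(i < n.+2) 'X^i) + c%:P) c0.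
exists d => //=; rewrite IHn /Phi1 Ed; congr (_, _).
(* Up to the factor [d], this is 1 + X (1 + ... + X^(n+1)) = 1 + ... + X^(n+2). *)
rewrite [in RHS]big_ord_recl expr0 -alg_polyC -scalerAr -scalerDr scalerA divfK //.
rewrite addrC mulr_sumr; congr (_ *: (_ + _)).
by apply: eq_bigr => i _; rewrite -exprS.
Qed.

Lemma unity_root_denominator (R : realType) (n : nat) (y : R[i]) :
  y ^+ n.+2 = 1 -> y != 1 -> denominator_roots R y.
Proof.
move=> yn y1; exists (nseq n true).
have [c c0 Ec] := backward_tree_true n; rewrite /denominator Ec.
rewrite /root /= map_polyZ hornerZ mulf_eq0 fmorph_eq0 (negPf c0) /=.
rewrite rmorph_sum horner_sum /=.
have -> : \sum_(i < n.+2) (map_poly ratr 'X^i).[y] = \sum_(i < n.+2) y ^+ i.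
  by apply: eq_bigr => i _; rewrite map_polyXn hornerXn.
have: (y - 1) * \sum_(i < n.+2) y ^+ i == 0 by rewrite -subrX1 yn subrr.
by rewrite mulf_eq0 subr_eq0 (negPf y1).
Qed.

Lemma parallelogram (C : numClosedFieldType) (x y : C) :
  `|x - y| ^+ 2 + `|x + y| ^+ 2 = 2 * (`|x| ^+ 2 + `|y| ^+ 2).
Proof. by rewrite !normCK rmorphB rmorphD; ring. Qed.

Lemma root_opp1_near (C : numClosedFieldType) (k : nat) (z : C) : `|z| = 1 ->
  exists2 y : C, y ^+ (2 ^ k) = -1 & `|z - y| ^+ 2 <= 4 / 2 ^+ k.
Proof.
elim: k z => [|k IHk] z z1.
  (* For exponent 1 the only choice is -1, at distance at most 2 from [z]; its square is the 4 in
     the bound. *)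
  exists (-1); rewrite ?expr1 // expr0 divr1 opprK.
  have -> : 4 = 2 ^+ 2 :> C by ring.
  rewrite lerXn2r ?nnegrE //; apply: le_trans (ler_normD _ _) _.
  by rewrite z1 normr1.
have [|y yk ley] := IHk (z ^+ 2); first by rewrite normrX z1 expr1n.
have [s sy] : {s : C | s ^+ 2 = y} by exists (sqrtC y); rewrite sqrtCK.
have sk : s ^+ (2 ^ k.+1) = -1 by rewrite expnS exprM sy.
have s1 : `|s| = 1.
  apply/eqP; rewrite -(@pexpr_eq1 _ _ (2 ^ k.+1)) ?expn_gt0 //.
  by rewrite -normrX sk normrN1.
have eprod : `|z - s| ^+ 2 * `|z + s| ^+ 2 = `|z ^+ 2 - y| ^+ 2.
  by rewrite -exprMn -normrM -sy -subr_sqr.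
have esum : `|z - s| ^+ 2 + `|z + s| ^+ 2 = 4.
  by rewrite parallelogram z1 s1; ring.
(* [a] and [b] will be the squared distances from [z] to [s] and to [- s], in either order. *)
have half (a b : C) : 0 <= a -> 2 <= b -> a * b = `|z ^+ 2 - y| ^+ 2 ->
    a <= 4 / 2 ^+ k.+1.
  move=> a0 b2 ab; rewrite exprS invfM mulrCA mulrC ler_pdivlMr //.
  by apply: le_trans ley; rewrite -ab ler_wpM2l.
have [b2|b2] : (2 <= `|z + s| ^+ 2) \/ (2 <= `|z - s| ^+ 2).
(* The order on [C] is partial; the two sides are comparable because both are real. *)
- have := real_leP (ger0_real (ler0n C 2)) (ger0_real (exprn_ge0 2 (normr_ge0 (z + s)))).
  case=> [le2|lt2]; [by left | right].
  by rewrite -(lerD2r (`|z + s| ^+ 2)) esum (natrD C 2 2) lerD2l ltW.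
- by exists s => //; apply: half b2 eprod; rewrite exprn_ge0.
- exists (- s); first by rewrite expnS exprM sqrrN sy.
  by rewrite opprK; apply: half b2 _; rewrite ?exprn_ge0 // mulrC.
Qed.

Lemma complex_exp2_small (R : realType) (e : R[i]) : 0 < e ->
  exists k : nat, 4 / 2 ^+ k < e.
Proof.
(* Positivity in [R[i]] forces a zero imaginary part, so the archimedean property of [R] applies to
   [a]. *)
case: e => a b; rewrite ltcE /= => /andP[/eqP -> a0].
set k := (Num.truncn (4 / a)).+1; exists k.
have lek : 4 / a < 2 ^+ k :> R.
  apply: lt_trans (truncnS_gt _) _.
  by rewrite -natrX ltr_nat; rewrite ltn_expl.
have -> : 4 / 2 ^+ k = (4 / 2 ^+ k)%:C%C :> R[i].
  by rewrite rmorphM fmorphV rmorphXn !rmorph_nat.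
by rewrite ltcR ltr_pdivrMr ?exprn_gt0 // mulrC -ltr_pdivrMr.
Qed.

Theorem proposition3p4 (R : realType) :
  unit_circle R `<=` closure (denominator_roots R).
Proof.
move=> z z1 B /nbhs_normP[e /= e0 Be].
(* The radius is squared because the approximation bounds a squared distance. *)
have [k ke] := complex_exp2_small R _ (exprn_gt0 2 e0).
have [y yk ley] := root_opp1_near _ k z z1.
exists y; split; last first.
  apply: Be => /=; rewrite -(@ltr_pXn2r _ 2) ?nnegrE ?normr_ge0 ?ltW //.
  exact: le_lt_trans ley ke.
(* Squaring y^(2^k) = -1 gives y^(2^(k+1)) = 1; subtracting 2 fits the exponent [n.+2]. *)
apply: (unity_root_denominator R (2 ^ k.+1 - 2)).
  rewrite -addn2 subnK ?expnS ?leq_pmulr ?expn_gt0 //.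
  by rewrite mulnC exprM yk sqrrN expr1n.
apply/eqP => y1; move: yk; rewrite y1 expr1n => /eqP.
by rewrite -addr_eq0 -mulr2n pnatr_eq0.
Qed.
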